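(* Let $\mathcal{GO}$ be a bivariate general overlap function, let $N$ be a strong fuzzy negation, and let $I_{\mathcal{GO}}^{N}(x,y)=N(\mathcal{GO}(x,N(y)))$ for $x,y\in[0,1]$. Then: (i) $I_{\mathcal{GO}}^{N}$ satisfies (NP) if and only if $1$ is the neutral element of $\mathcal{GO}$. (ii) $I_{\mathcal{GO}}^{N}$ satisfies (EP) if and only if $\mathcal{GO}$ is associative.
   Context: A fuzzy negation is a map $N:[0,1]\to[0,1]$ with $N(0)=1$, $N(1)=0$ and $N(x)\le N(y)$ whenever $y\le x$. It is strong if $N(N(x))=x$ for all $x\in[0,1]$. A bivariate general overlap function is a function $\mathcal{GO}:[0,1]^2\to[0,1]$ such that for all $x,y\in[0,1]$: (1) $\mathcal{GO}(x,y)=\mathcal{GO}(y,x)$; (2) if $xy=0$ then $\mathcal{GO}(x,y)=0$; (3) if $xy=1$ then $\mathcal{GO}(x,y)=1$; (4) $\mathcal{GO}$ is increasing (in the non-strict sense) in each variable; (5) $\mathcal{GO}$ is continuous. An element $a\in[0,1]$ is a neutral element of $\mathcal{GO}$ if $\mathcal{GO}(x,a)=x$ for all $x\in[0,1]$. A function $I:[0,1]^2\to[0,1]$ satisfies (NP) if $I(1,y)=y$ for all $y\in[0,1]$; it satisfies (EP) if $I(x,I(y,z))=I(y,I(x,z))$ for all $x,y,z\in[0,1]$. *)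

(* Defs.v *)
From HB Require Import structures.
From mathcomp Require Import all_boot all_order all_algebra.
From mathcomp Require Import all_classical all_reals all_analysis.
Set Implicit Arguments.
Unset Strict Implicit.
Unset Printing Implicit Defensive.
Import Order.TTheory GRing.Theory Num.Theory.
Import numFieldNormedType.Exports.
Local Open Scope classical_set_scope.
Local Open Scope ring_scope.

(* Maps [0,1] -> [0,1] and [0,1]^2 -> [0,1] are
   total functions on R that are only constrained and only examined on the
   unit interval; their values elsewhere are arbitrary. *)

Section FuzzyConnectives.
Variable R : realType.

Definition maps01 (f : R -> R) : Prop :=
  forall x : R, x \in `[0, 1] -> f x \in `[0, 1].

Definition maps01_2 (f : R -> R -> R) : Prop :=
  forall x y : R, x \in `[0, 1] -> y \in `[0, 1] -> f x y \in `[0, 1].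

Record fuzzy_negation (N : R -> R) : Prop := FuzzyNegation {
  neg_maps01 : maps01 N;
  neg0 : N 0 = 1;
  neg1 : N 1 = 0;
  neg_anti : forall x y : R, x \in `[0, 1] -> y \in `[0, 1] -> y <= x -> N x <= N y
}.

Definition strong_fuzzy_negation (N : R -> R) : Prop :=
  fuzzy_negation N /\ forall x : R, x \in `[0, 1] -> N (N x) = x.

Record general_overlap (GO : R -> R -> R) : Prop := GeneralOverlap {
  go_maps01 : maps01_2 GO;
  go_comm : forall x y : R, x \in `[0, 1] -> y \in `[0, 1] -> GO x y = GO y x;
  go_eq0 : forall x y : R, x \in `[0, 1] -> y \in `[0, 1] ->
    x * y = 0 -> GO x y = 0;
  go_eq1 : forall x y : R, x \in `[0, 1] -> y \in `[0, 1] ->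
    x * y = 1 -> GO x y = 1;
  go_mono_l : forall x x' y : R,
    x \in `[0, 1] -> x' \in `[0, 1] -> y \in `[0, 1] ->
    x <= x' -> GO x y <= GO x' y;
  go_mono_r : forall x y y' : R,
    x \in `[0, 1] -> y \in `[0, 1] -> y' \in `[0, 1] ->
    y <= y' -> GO x y <= GO x y';
  (* joint continuity, for the subspace topology of the unit square *)
  go_continuous :
    {within `[0, 1]%classic `*` `[0, 1]%classic,
      continuous (fun p : R * R => GO p.1 p.2)}
}.

Definition neutral_element (GO : R -> R -> R) (a : R) : Prop :=
  a \in `[0, 1] /\ forall x : R, x \in `[0, 1] -> GO x a = x.

Definition associative01 (GO : R -> R -> R) : Prop :=
  forall x y z : R, x \in `[0, 1] -> y \in `[0, 1] -> z \in `[0, 1] ->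
    GO x (GO y z) = GO (GO x y) z.

Definition NP (I : R -> R -> R) : Prop :=
  forall y : R, y \in `[0, 1] -> I 1 y = y.

Definition EP (I : R -> R -> R) : Prop :=
  forall x y z : R, x \in `[0, 1] -> y \in `[0, 1] -> z \in `[0, 1] ->
    I x (I y z) = I y (I x z).

Definition GON_implication (GO : R -> R -> R) (N : R -> R) : R -> R -> R :=
  fun x y => N (GO x (N y)).

End FuzzyConnectives.

(* Main.v *)
Require Import Defs.
From mathcomp Require Import all_boot all_order all_algebra.
From mathcomp Require Import all_classical all_reals all_analysis.

(** A strong negation [N] is an involution of the unit interval, so every point
    of the interval is some [N y] and [N] can be cancelled there. Both claims
    become identities about [GO] alone once the two negations are removed.

    For (NP), [N (GO 1 (N y)) = y] for all [y] says [GO 1 w = w] for all [w],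
    which by commutativity is neutrality of 1.

    For (EP), the inner negations of the nested implication cancel:
    [I x (I y z) = N (GO x (GO y (N z)))]. Hence (EP) is the exchange law
    [GO x (GO y w) = GO y (GO x w)] ([EP_GON_exchange]), and for a commutative
    operation the exchange law is a rewriting of associativity
    ([exchange_associative]). *)

Import Order.TTheory GRing.Theory Num.Theory.
Local Open Scope ring_scope.

Definition exchange01 {R : realType} (GO : R -> R -> R) : Prop :=
  forall x y z : R, x \in `[0, 1] -> y \in `[0, 1] -> z \in `[0, 1] ->
    GO x (GO y z) = GO y (GO x z).

Lemma one_in01 (R : realType) : (1 : R) \in `[0, 1].
Proof. by rewrite in_itv /= ler01 lexx. Qed.

Lemma strong_negation_inj {R : realType} {N : R -> R} (x y : R) :
  strong_fuzzy_negation N -> x \in `[0, 1] -> y \in `[0, 1] ->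
  N x = N y -> x = y.
Proof. by move=> [_ NK] x01 y01 eqN; rewrite -(NK x x01) eqN NK. Qed.

(** Associativity moves the bracket and commutativity swaps the two outer
    arguments; the exchange law does both at once. *)
Lemma exchange_associative {R : realType} {GO : R -> R -> R} :
  maps01_2 GO ->
  (forall x y : R, x \in `[0, 1] -> y \in `[0, 1] -> GO x y = GO y x) ->
  exchange01 GO <-> associative01 GO.
Proof.
move=> GO01 GOC; split=> [GOX|GOA] x y z x01 y01 z01.
  by rewrite (GOC y z) // GOX // GOC // GO01.
by rewrite GOA // (GOC x y) // -GOA.
Qed.

Lemma GON_nested {R : realType} {GO : R -> R -> R} {N : R -> R} (x y z : R) :
  maps01_2 GO -> strong_fuzzy_negation N -> y \in `[0, 1] -> z \in `[0, 1] ->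
  GON_implication GO N x (GON_implication GO N y z) = N (GO x (GO y (N z))).
Proof.
move=> GO01 [fN NK] y01 z01; rewrite /GON_implication NK //.
exact: GO01 y01 (neg_maps01 fN z01).
Qed.

(** The third argument of the exchange law is [N z], and it still ranges over
    the whole unit interval because [N] is onto. *)
Lemma EP_GON_exchange {R : realType} {GO : R -> R -> R} {N : R -> R} :
  maps01_2 GO -> strong_fuzzy_negation N ->
  EP (GON_implication GO N) <-> exchange01 GO.
Proof.
move=> GO01 sN; have [fN NK] := sN; have N01 := neg_maps01 fN.
split=> [IEP|GOX] x y z x01 y01 z01; last first.
  by rewrite !GON_nested // GOX // N01.
have := IEP x y (N z) x01 y01 (N01 z z01).
rewrite !GON_nested ?N01 // NK //.
by apply: strong_negation_inj => //; apply: (GO01) => //; apply: GO01.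
Qed.

Lemma NP_GON_neutral {R : realType} {GO : R -> R -> R} {N : R -> R} :
  maps01_2 GO ->
  (forall x y : R, x \in `[0, 1] -> y \in `[0, 1] -> GO x y = GO y x) ->
  strong_fuzzy_negation N ->
  NP (GON_implication GO N) <-> neutral_element GO 1.
Proof.
move=> GO01 GOC sN; have [fN NK] := sN; have N01 := neg_maps01 fN.
have i1 := one_in01 R.
split=> [INP|[_ GO1] y y01]; last first.
  by rewrite /GON_implication GOC ?N01 // GO1 ?N01 // NK.
split=> // x x01; rewrite GOC //.
have := INP (N x) (N01 x x01); rewrite /GON_implication NK //.
by apply: strong_negation_inj => //; apply: GO01.
Qed.

Theorem proposition14 (R : realType) (GO : R -> R -> R) (N : R -> R)
    (hGO : general_overlap GO) (hN : strong_fuzzy_negation N) :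
  (NP (GON_implication GO N) <-> neutral_element GO 1%R) /\
  (EP (GON_implication GO N) <-> associative01 GO).
Proof.
have GO01 := go_maps01 hGO; have GOC := go_comm hGO.
split; first exact: NP_GON_neutral.
exact: iff_trans (EP_GON_exchange GO01 hN) (exchange_associative GO01 GOC).
Qed.
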